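(* Let $X$ be a real-valued random variable, let $\alpha\in(0,1)$, $n\in\mathbb{N}$ with $n\ge 1$, and $s\in\left(0,\tfrac12\right)$, and let $X_1,\dots,X_n$ be i.i.d. samples with the distribution of $X$. Put $\alpha^-=\alpha-\frac{1}{2n^{s}}$, $\alpha^+=\alpha+\frac{1}{2n^{s}}$, $a_n=\hat F_n^{-1}(\alpha^-)$ and $b_n=\hat F_n^{-1}(\alpha^+)$. Then $$\mathbb{P}\left[v_\alpha(X)\in[a_n,b_n]\right]\ \ge\ 1-2\exp\left(-\frac{n^{1-2s}}{8}\right).$$
   Context: The Value-at-Risk of $X$ at level $\alpha\in(0,1)$ is $v_\alpha(X)=\inf\{\xi\in\mathbb{R}:\mathbb{P}[X\le\xi]\ge\alpha\}$. The empirical distribution function of the sample is $\hat F_n(x)=\frac1n\sum_{i=1}^n\mathbb{I}\{X_i\le x\}$, and for real $p$ one sets $\hat F_n^{-1}(p)=\inf\{x\in\mathbb{R}:\hat F_n(x)\ge p\}$, as an element of $[-\infty,+\infty]$ (so it equals $-\infty$ if $p\le 0$ and $+\infty=\inf\emptyset$ if $p>1$); the interval $[a_n,b_n]$ is understood in the extended reals. *)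

(* Defs.v *)
From mathcomp Require Import all_boot all_order all_algebra.
From mathcomp Require Import all_classical all_reals all_analysis.
Import Order.TTheory GRing.Theory Num.Theory.
Import numFieldNormedType.Exports.
Set Implicit Arguments.
Unset Strict Implicit.
Unset Printing Implicit Defensive.

Local Open Scope classical_set_scope.
Local Open Scope ring_scope.

Section Defs.
Context d (T : measurableType d) (R : realType) (P : probability T R).

(* [inf] is the real-valued infimum; for [0 < alpha < 1] the set is nonempty
   and bounded below, so the default value of [inf] is never used. *)
Definition VaR (X : {RV P >-> R}) (alpha : R) : R :=
  inf [set xi : R | (alpha%:E <= P [set w | (X w <= xi)%R])%E].

Definition mutually_independent (n : nat) (X : 'I_n -> {RV P >-> R}) : Prop :=
  forall (J : {set 'I_n}) (B : 'I_n -> set R),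
    (forall i, measurable (B i)) ->
    P (\bigcap_(i in [set` J]) (X i @^-1` B i)) =
    (\prod_(i in J) P (X i @^-1` B i))%E.

Definition iid_samples (n : nat) (X : {RV P >-> R})
    (Xs : 'I_n -> {RV P >-> R}) : Prop :=
  mutually_independent Xs /\
  (forall (i : 'I_n) (B : set R),
     measurable B -> distribution P (Xs i) B = distribution P X B).

End Defs.

Section Empirical.
Context (T : Type) (R : realType) (n : nat) (Xs : 'I_n -> T -> R).

Definition ecdf (w : T) (x : R) : R :=
  n%:R^-1 * \sum_(i < n) (Xs i w <= x)%R%:R.

(* [ereal_inf] sends [set0] to [+oo] and the image of all of [R] to [-oo]. *)
Definition equantile (w : T) (p : R) : \bar R :=
  ereal_inf [set x%:E | x in [set x : R | p <= ecdf w x]].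

End Empirical.

(* Main.v *)
(* Since the empirical distribution function is a right-continuous step function,
   [a_n <= v <= b_n] holds exactly when [F_n(v) >= alpha^-] and
   [F_n(v-) < alpha^+]. As [F(v) >= alpha >= F(v-)] for [v] the Value-at-Risk,
   each of the two conditions fails only if a binomial frequency exceeds its mean
   by [t = 1/(2 n^s) <= 1/2], which the Chernoff method bounds by
   [exp(-n t^2/2) = exp(-n^(1-2s)/8)]. For [t <= 1/2] the exponential parameter
   [t] itself is good enough, and the moment generating function is controlled by
   the elementary bound [exp x <= 1 + x + 2 x^2] valid for [x <= 1/2]. *)
Require Import Defs.
From mathcomp Require Import all_boot all_order all_algebra.
From mathcomp Require Import all_classical all_reals all_analysis.
From mathcomp Require Import measurable_realfun ring lra.
Import Order.TTheory GRing.Theory Num.Theory.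
Import numFieldNormedType.Exports.

Local Open Scope classical_set_scope.
Local Open Scope ring_scope.

(** * Elementary exponential bounds *)

(** From [exp (- x) >= 1 - x] one gets [exp x <= 1 / (1 - x)], and [(1 + x + 2 x^2) (1 - x) = 1 +
    x^2 (1 - 2 x)] is at least 1 here. *)
Lemma expR_le_quadratic (R : realType) (x : R) :
  x <= 1 / 2 -> expR x <= 1 + x + 2 * x ^+ 2.
Proof.
move=> hx; have x1 : 0 < 1 - x by lra.
rewrite -[leLHS]invrK -expRN.
apply: (@le_trans _ _ (1 - x)^-1).
  by rewrite lef_pV2 ?posrE ?expR_gt0//; have := expR_ge1Dx (- x); lra.
rewrite -[leLHS]mul1r ler_pdivrMr//.
have : 0 <= x ^+ 2 * (1 - 2 * x) by apply: mulr_ge0; [exact: sqr_ge0 | lra].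
nra.
Qed.

(** Moment generating function of a centred Bernoulli variable: in the quadratic bounds the linear
    terms cancel, leaving [2 l^2 p (1 - p) <= l^2 / 2]. *)
Lemma bernoulli_mgf_le (R : realType) (p l : R) :
  0 <= p <= 1 -> 0 <= l <= 1 / 2 ->
  p * expR (l * (1 - p)) + (1 - p) * expR (- (l * p)) <= expR (l ^+ 2 / 2).
Proof.
move=> /andP[p0 p1] /andP[l0 l1].
have h1 : expR (l * (1 - p)) <= 1 + l * (1 - p) + 2 * (l * (1 - p)) ^+ 2.
  by apply: expR_le_quadratic; nra.
have h2 : expR (- (l * p)) <= 1 + - (l * p) + 2 * (- (l * p)) ^+ 2.
  by apply: expR_le_quadratic; nra.
apply: le_trans (expR_ge1Dx _).
have := ler_wpM2l p0 h1.
have p1' : 0 <= 1 - p by lra.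
have := ler_wpM2l p1' h2.
have := mulr_ge0 (sqr_ge0 l) (sqr_ge0 (2 * p - 1)).
nra.
Qed.

(** * Products of indicators, expanded over subsets *)

Lemma prod_affine_expand (R : comPzRingType) (n : nat) (u c : R) (b : 'I_n -> R) :
  \prod_(i < n) (u + c * b i)
  = \sum_(J : {set 'I_n}) c ^+ #|J| * u ^+ (n - #|J|) * \prod_(i in J) b i.
Proof.
under eq_bigr do rewrite addrC.
rewrite bigA_distr; apply: eq_bigr => J _.
rewrite (bigID (mem J)) /=.
under eq_bigr => i iJ do rewrite iJ.
under [X in _ * X]eq_bigr => i /negbTE iJ do rewrite iJ.
rewrite big_split /= !prodr_const mulrAC.
suff -> : #|[pred i | i \notin J]| = (n - #|J|)%N by [].
by apply/esym/eqP; rewrite -(eqn_add2l #|J|) subnKC ?cardC ?card_ord// -[leqRHS]card_ord max_card.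
Qed.

Lemma prod_indic (R : comPzRingType) (T : Type) (I : finType) (J : {set I})
    (E : I -> set T) (w : T) :
  \prod_(i in J) \1_(E i) w = \1_(\bigcap_(i in [set` J]) E i) w :> R.
Proof.
rewrite [RHS]indicE; case: (boolP (w \in _)) => [/set_mem wE|/negP wE].
  by rewrite big1// => i iJ; rewrite indicE mem_set//; exact: wE.
have [i /andP[iJ wi]|H] := pickP [pred i | (i \in J) && (w \notin E i)].
  by rewrite (bigD1 i)//= indicE (negbTE wi) mul0r.
case: wE; apply/mem_set => i /= iJ; apply/set_mem.
by have := H i; rewrite /= iJ /= => /negbFE.
Qed.

Lemma indic_preimage_itv (T : Type) (R : realType) (f : T -> R) (I : interval R) (w : T) :
  \1_(f @^-1` [set` I]) w = (f w \in I)%:R :> R.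
Proof. by rewrite indicE; rewrite (_ : (w \in _) = (f w \in I))//; apply/idP/idP; rewrite inE. Qed.

(** * Chernoff bound for a count of independent events *)

Section Chernoff.
Context d (T : measurableType d) (R : realType) (P : probability T R).

(* Expanding the product over subsets reduces the expectation to probabilities
   of intersections, so independence of functions is never needed. *)
Lemma integral_prod_indic (n : nat) (E : 'I_n -> set T) (p u c : R) :
  (forall i, measurable (E i)) ->
  (forall J : {set 'I_n},
    P (\bigcap_(i in [set` J]) E i) = (p ^+ #|J|)%:E) ->
  0 <= u -> 0 <= c ->
  (\int[P]_w (\prod_(i < n) (u + c * \1_(E i) w))%:E)%E
  = ((u + c * p) ^+ n)%:E.
Proof.
move=> mE PE u0 c0.
have mI (J : {set 'I_n}) : measurable (\bigcap_(i in [set` J]) E i).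
  by apply: fin_bigcap_measurable => //; exact: finite_finset.
under eq_integral do rewrite prod_affine_expand -sumEFin.
rewrite ge0_integral_sum//=; last 2 first.
- move=> J; under eq_fun do rewrite prod_indic.
  by apply/measurable_EFinP; apply: measurable_funM.
- by move=> J w _; rewrite lee_fin prod_indic mulr_ge0// mulr_ge0// exprn_ge0.
(* The same expansion, with every [b i] equal to [p], makes the two sums agree term by term. *)
rewrite -[in RHS](card_ord n) -prodr_const prod_affine_expand -sumEFin.
apply: eq_bigr => J _; rewrite prodr_const.
under eq_integral do rewrite prod_indic EFinM.
rewrite ge0_integralZl_EFin//; last first.
- by rewrite mulr_ge0// exprn_ge0.
- by apply/measurable_EFinP.
by rewrite integral_indic// setIT [RHS]EFinM; congr (_ * _)%E; exact: PE.
Qed.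

Lemma measurable_count_ge (n : nat) (E : 'I_n -> set T) (r : R) :
  (forall i, measurable (E i)) ->
  measurable [set w | r <= \sum_(i < n) \1_(E i) w].
Proof.
move=> mE.
have -> : [set w | r <= \sum_(i < n) \1_(E i) w]
    = (fun w => \sum_(i < n) \1_(E i) w) @^-1` `[r, +oo[.
  by apply/seteqP; split => w; rewrite /= in_itv/= andbT.
rewrite -[X in measurable X]setTI.
exact: (measurable_sum _ (fun i => measurable_indic (mE i))).
Qed.

(** Exponential Markov inequality with parameter [t]: the factor [exp (- n t^2)] meets a moment
    generating function of at most [exp (n t^2 / 2)]. *)
Lemma chernoff_count (n : nat) (E : 'I_n -> set T) (p t : R) :
  (forall i, measurable (E i)) ->
  (forall J : {set 'I_n},
    P (\bigcap_(i in [set` J]) E i) = (p ^+ #|J|)%:E) ->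
  0 <= p <= 1 -> 0 <= t <= 1 / 2 ->
  (P [set w | (n%:R * (p + t) <= \sum_(i < n) \1_(E i) w)%R]
   <= (expR (- (n%:R * t ^+ 2 / 2)))%:E)%E.
Proof.
move=> mE PE p01 t01; set A := [set w | _].
have mA : measurable A by exact: measurable_count_ge.
(* At the two values of an indicator, [exp (t (y - p))] agrees with the affine function
   [u + c y]. *)
pose u := expR (- (t * p)); pose c := expR (t * (1 - p)) - u.
have c0 : 0 <= c by rewrite subr_ge0 ler_expR; lra.
have factor i w : u + c * \1_(E i) w = expR (t * (\1_(E i) w - p)).
  rewrite indicE; case: (w \in E i) => /=.
    by rewrite /c mulr1 addrC subrK.
  by rewrite mulr0 addr0 /u sub0r mulrN.
have mf : measurable_fun setT (fun w => \prod_(i < n) (u + c * \1_(E i) w)).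
  by apply: measurable_prod => i _; apply: measurable_funD => //; apply: measurable_funM.
have prodE w : \prod_(i < n) (u + c * \1_(E i) w)
    = expR (t * (\sum_(i < n) \1_(E i) w - n%:R * p)).
  under eq_bigr do rewrite factor.
  rewrite -expR_sum -mulr_sumr sumrB sumr_const card_ord.
  by rewrite mulr_natl.
rewrite -[A]setIT -integral_indic//.
(* On [A] the total exponent is [t] times the excess of the count over [n (p + t)], hence
   nonnegative. *)
apply: (@le_trans _ _ (\int[P]_w ((expR (- (n%:R * t ^+ 2)))%:E
    * (\prod_(i < n) (u + c * \1_(E i) w))%:E))%E).
  apply: ge0_le_integral => //.
  - by apply/measurable_EFinP.
  - by apply/measurable_EFinP; apply: measurable_funM.
  move=> w _; rewrite lee_fin prodE -expRD indicE.
  case: (boolP (w \in A)) => [/set_mem wA|_]; last exact: expR_ge0.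
  rewrite -[leLHS]expR0 ler_expR.
  have : 0 <= t * (\sum_(i < n) \1_(E i) w - n%:R * (p + t)).
    by rewrite mulr_ge0 ?subr_ge0//; lra.
  lra.
rewrite ge0_integralZl_EFin ?expR_ge0//; last 2 first.
- by move=> w _; rewrite lee_fin prodE expR_ge0.
- by apply/measurable_EFinP.
rewrite (integral_prod_indic _ _ p) ?expR_ge0// -EFinM lee_fin.
have -> : u + c * p = p * expR (t * (1 - p)) + (1 - p) * expR (- (t * p)).
  by rewrite /c /u; ring.
apply: (@le_trans _ _ (expR (- (n%:R * t ^+ 2)) * expR (t ^+ 2 / 2) ^+ n)).
  rewrite ler_wpM2l ?expR_ge0// lerXn2r ?nnegrE ?expR_ge0//; last exact: bernoulli_mgf_le.
  by rewrite addr_ge0// mulr_ge0 ?expR_ge0//; lra.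
by rewrite -expRM_natl -expRD ler_expR; lra.
Qed.

End Chernoff.

(** * The distribution function at the Value-at-Risk *)

Section VaR.
Context d (T : measurableType d) (R : realType) (P : probability T R).
Context (X : {RV P >-> R}) (alpha : R).
Context (alpha0 : 0 < alpha) (alpha1 : alpha < 1).

Let S := [set xi : R | (alpha%:E <= cdf X xi)%E].

Let VaRE : VaR X alpha = inf S.
Proof.
rewrite /VaR; congr inf; apply/seteqP; split => x /=;
 by rewrite /S/= /cdf /distribution /pushforward /= set_itvNyc.
Qed.

(** The limits 1 and 0 of the cdf at the two infinities make [S] nonempty and bounded below. *)
Lemma has_inf_VaR : has_inf S.
Proof.
split.
  have : \forall x \near +oo, (alpha%:E < cdf X x)%E.
    have a1 : (alpha%:E < 1)%E by rewrite lte_fin.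
    exact: (cvg_cdfy1 X (open_ereal_gt' a1)).
  by move=> /filter_ex [x /ltW]; exists x.
have : \forall x \near -oo, (cdf X x < alpha%:E)%E.
  have a0 : (0 < alpha%:E)%E by rewrite lte_fin.
  exact: (cvg_cdfNy0 X (open_ereal_lt' a0)).
move=> /filter_ex [x xa]; exists x => y /= Sy.
rewrite leNgt; apply/negP => /ltW yx.
have := cdf_nondecreasing X yx.
by rewrite leNgt (lt_le_trans xa).
Qed.

(** Otherwise right continuity keeps the cdf below [alpha] at some [x] to the right of the infimum,
    yet [S] has an element below [x]. *)
Lemma cdf_VaR_ge : (alpha%:E <= cdf X (VaR X alpha))%E.
Proof.
rewrite leNgt; apply/negP => Fv.
have H : \forall x \near (VaR X alpha)^'+, (cdf X x < alpha%:E)%E /\ VaR X alpha < x.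
  apply: filterI; last exact: nbhs_right_gt.
  exact: (cdf_right_continuous (open_ereal_lt' Fv)).
have [x [xa vx]] := @filter_ex _ _ (at_right_proper_filter _) _ H.
have [y Sy yx] : exists2 y, S y & y < x by apply: inf_lt; [exact: has_inf_VaR.1 | rewrite -VaRE].
by have := le_trans Sy (cdf_nondecreasing X (ltW yx)); rewrite leNgt xa.
Qed.

(** Continuity from below along the events [X <= v - 1/(k+1)]: points left of the infimum are not in
    [S]. *)
Lemma prob_lt_VaR_le : (P (X @^-1` `]-oo, VaR X alpha[) <= alpha%:E)%E.
Proof.
set v := VaR X alpha.
pose F (k : nat) := X @^-1` `]-oo, v - k.+1%:R^-1].
have -> : X @^-1` `]-oo, v[ = \bigcup_k F k.
  rewrite -preimage_bigcup; congr (_ @^-1` _).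
  apply/seteqP; split => x /=; rewrite ?in_itv/=.
    rewrite -subr_gt0 => /ltr_add_invr[k]; rewrite add0r => kx.
    by exists k => //=; rewrite in_itv/= lerBrDr -lerBrDl ltW.
  move=> [k _] /=; rewrite in_itv/= => /le_lt_trans; apply.
  by rewrite ltrBlDr ltrDl invr_gt0.
have mF k : measurable (F k) by exact: measurable_funPTI.
have cF : P \o F @ \oo --> P (\bigcup_n F n).
  apply: nondecreasing_cvg_mu => //; first exact: bigcup_measurable.
  move=> n m nm; apply/subsetPset => x /=; rewrite /F/= !in_itv/= => /le_trans; apply.
  by rewrite lerD2l lerN2 lef_pV2 ?posrE// ler_nat.
rewrite -(cvg_lim _ cF)//; apply: lime_le; first by apply/cvg_ex; eexists; exact: cF.
apply: nearW => k; rewrite leNgt; apply/negP => /ltW Sk.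
have := ge_inf has_inf_VaR.2 Sk.
by rewrite -VaRE -/v lerDl oppr_ge0 leNgt invr_gt0 ltr0n.
Qed.

End VaR.

(** * Empirical quantiles *)

Section Ecdf.
Context (T : Type) (R : realType) (n : nat) (Xs : 'I_n -> T -> R) (w : T).

Lemma ecdf_nondecreasing : nondecreasing_fun (ecdf Xs w).
Proof.
move=> x y xy; rewrite /ecdf ler_wpM2l ?invr_ge0//.
apply: ler_sum => i _; rewrite ler_nat.
by case: (leP (Xs i w) x) => // /le_trans ->.
Qed.

(** The sample is finite, so some [x > v] has no sample point in []v, x]]; the level [p], reached
    before [x], is then already reached at [v]. *)
Lemma equantile_leP (p v : R) :
  (equantile Xs w p <= v%:E)%E <-> p <= ecdf Xs w v.
Proof.
split => [qv|pv]; last by apply: ereal_inf_lbound; exists v.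
have nearX i : \forall x \near v^'+, v < Xs i w -> x < Xs i w.
  have [vX|Xv] := ltP v (Xs i w); last by near=> x.
  by near=> x => _; near: x; exact: nbhs_right_lt.
have [x [vx xX]] := @filter_ex _ _ (at_right_proper_filter _) _
  (filterI (nbhs_right_gt v) (filter_forall _ nearX)).
have /ereal_inf_lt [_ [y py <-]] : (equantile Xs w p < x%:E)%E by exact: le_lt_trans qv _.
rewrite lte_fin => yx.
apply: (le_trans py); apply: (le_trans (ecdf_nondecreasing _ _ (ltW yx))).
rewrite /ecdf ler_wpM2l ?invr_ge0// ler_sum// => i _; rewrite ler_nat.
by case: (leP (Xs i w) v) => [_|/xX]; [case: (_ <= _) | rewrite ltNge => /negbTE ->].
Unshelve. all: by end_near.
Qed.

(* The left-hand side of the inequality is the left limit [F_n(v-)]. *)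
Lemma le_equantileP (p v : R) :
  (v%:E <= equantile Xs w p)%E
  <-> n%:R^-1 * \sum_(i < n) (Xs i w < v)%R%:R < p.
Proof.
split => [vq|pv].
  (* Mirror argument: some [x < v] lies above every sample point that is below [v]. *)
  have nearX i : \forall x \near v^'-, Xs i w < v -> Xs i w < x.
    have [Xv|vX] := ltP (Xs i w) v; last by near=> x.
    by near=> x => _; near: x; exact: nbhs_left_gt.
  have [x [xv xX]] := @filter_ex _ _ (at_left_proper_filter _) _
    (filterI (nbhs_left_lt v) (filter_forall _ nearX)).
  rewrite ltNge; apply/negP => pe.
  have : (equantile Xs w p <= x%:E)%E.
    apply/equantile_leP; apply: (le_trans pe).
    rewrite /ecdf ler_wpM2l ?invr_ge0// ler_sum// => i _; rewrite ler_nat.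
    by case: ltP => // /xX /ltW ->.
  by move=> /(le_trans vq); rewrite lee_fin leNgt xv.
apply: le_ereal_inf_tmp => _ [x /= px <-]; rewrite lee_fin leNgt; apply/negP => xv.
have := lt_le_trans pv px; rewrite ltNge => /negP; apply.
rewrite /ecdf ler_wpM2l ?invr_ge0// ler_sum// => i _; rewrite ler_nat.
by case: (leP (Xs i w) x) => // /le_lt_trans ->.
Unshelve. all: by end_near.
Qed.

End Ecdf.

(** * Chernoff bound for i.i.d. samples *)

Section Iid.
Context d (T : measurableType d) (R : realType) (P : probability T R).
Context (X : {RV P >-> R}) (n : nat) (Xs : 'I_n -> {RV P >-> R}).
Context (hXs : iid_samples X Xs).

(** Replacing [p] by the exact probability [q <= p] only enlarges the event, and independence with
    the same [B] at each index gives the powers of [q]. *)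
Lemma iid_chernoff (B : set R) (p t : R) :
  measurable B -> (P (X @^-1` B) <= p%:E)%E -> 0 <= t <= 1 / 2 ->
  (P [set w | (n%:R * (p + t) <= \sum_(i < n) \1_(Xs i @^-1` B) w)%R]
   <= (expR (- (n%:R * t ^+ 2 / 2)))%:E)%E.
Proof.
move=> mB pB t01; pose q := fine (P (X @^-1` B)).
have mXB (Y : {RV P >-> R}) : measurable (Y @^-1` B) by exact: measurable_funPTI.
have qE : P (X @^-1` B) = q%:E by rewrite fineK// fin_num_measure.
have mXs i := mXB (Xs i).
apply: (@le_trans _ _ (P [set w | (n%:R * (q + t) <= \sum_(i < n) \1_(Xs i @^-1` B) w)%R])).
  apply: le_measure; rewrite ?inE; [exact: measurable_count_ge..|].
  move=> w /=; apply: le_trans; rewrite ler_wpM2l// lerD2r.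
  by rewrite -lee_fin -qE.
apply: chernoff_count => //.
  move=> J; have [indep ident] := hXs.
  rewrite (indep J (fun=> B))//.
  under eq_bigr => i _ do rewrite [P _](ident i B mB) [distribution P X B]qE.
  by rewrite prodEFin prodr_const.
rewrite -!lee_fin -qE measure_ge0/=; exact: probability_le1.
Qed.

End Iid.

(** * Coverage probability of the interval *)

Theorem proposition1 (d : measure_display) (T : measurableType d)
    (R : realType) (P : probability T R) (X : {RV P >-> R})
    (alpha : R) (n : nat) (s : R) (Xs : 'I_n -> {RV P >-> R})
    (halpha0 : 0 < alpha) (halpha1 : alpha < 1) (hn : (1 <= n)%N)
    (hs0 : 0 < s) (hs1 : s < 1 / 2)
    (hXs : iid_samples X Xs) :
  let alpham : R := alpha - 1 / (2 * n%:R `^ s) in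
  let alphap : R := alpha + 1 / (2 * n%:R `^ s) in
  let a (w : T) : \bar R := equantile Xs w alpham in
  let b (w : T) : \bar R := equantile Xs w alphap in
  (P [set w | a w <= (VaR X alpha)%:E <= b w]
   >= (1 - 2 * expR (- (n%:R `^ (1 - 2 * s) / 8)))%R%:E)%E.
Proof.
cbv zeta; set t := 1 / (2 * n%:R `^ s); set v := VaR X alpha.
have n0 : (0 : R) < n%:R by rewrite ltr0n.
(* This yields [t <= 1/2], the range of the Chernoff bound. *)
have ns1 : 1 <= n%:R `^ s.
  by rewrite -[leLHS](powRr0 n%:R) ler_powR ?ler1n// ltW.
have t01 : 0 <= t <= 1 / 2.
  apply/andP; split; first by rewrite divr_ge0// mulr_ge0// powR_ge0.
  rewrite ler_wpM2l// lef_pV2 ?posrE; lra.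
have ntE : n%:R * t ^+ 2 / 2 = n%:R `^ (1 - 2 * s) / 8.
  have -> : n%:R `^ (1 - 2 * s) = n%:R / (n%:R `^ s) ^+ 2.
    have nN0 : (n%:R : R) != 0 by rewrite gt_eqF.
    rewrite powRB; last by rewrite nN0 implybT.
    by rewrite powRr1 ?ltW// [2 * s]mulrC powRrM powR_mulrn// powR_ge0.
  by rewrite /t; field; rewrite gt_eqF//; lra.
(* The bad events: too many samples strictly above [v], or strictly below it. A single sample falls
   there with probability at most [1 - alpha], respectively [alpha]. *)
pose U := [set w | n%:R * (1 - alpha + t) <= \sum_(i < n) \1_(Xs i @^-1` `]v, +oo[) w].
pose L := [set w | n%:R * (alpha + t) <= \sum_(i < n) \1_(Xs i @^-1` `]-oo, v[) w].
have mU : measurable U by apply: measurable_count_ge => i; exact: measurable_funPTI.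
have mL : measurable L by apply: measurable_count_ge => i; exact: measurable_funPTI.
have PL : (P L <= (expR (- (n%:R `^ (1 - 2 * s) / 8)))%:E)%E.
  rewrite -ntE; apply: (iid_chernoff _ _ _ P X _ Xs hXs) => //; exact: (prob_lt_VaR_le _ _ _ P X _ halpha0 halpha1).
have PU : (P U <= (expR (- (n%:R `^ (1 - 2 * s) / 8)))%:E)%E.
  rewrite -ntE; apply: (iid_chernoff _ _ _ P X _ Xs hXs) => //.
  have -> : X @^-1` `]v, +oo[ = ~` (X @^-1` `]-oo, v]) by rewrite -setCitvl.
  rewrite probability_setC; last exact: measurable_funPTI.
  rewrite EFinB; apply: leeB => //; exact: (cdf_VaR_ge _ _ _ P X _ halpha0 halpha1).
(* [G] says that the empirical distribution function at [v] is at least [alpha - t]. *)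
pose G := [set w | n%:R * (alpha - t) <= \sum_(i < n) \1_(Xs i @^-1` `]-oo, v]) w].
have mG : measurable G by apply: measurable_count_ge => i; exact: measurable_funPTI.
have -> : [set w | (equantile Xs w (alpha - t) <= v%:E <= equantile Xs w (alpha + t))%E] = G `&` ~` L.
  apply/seteqP; split => w /=.
    move=> /andP[/equantile_leP aw /le_equantileP bw]; split.
      move: aw; rewrite /ecdf mulrC ler_pdivlMr// mulrC => /le_trans; apply.
      by apply: ler_sum => i _; rewrite indic_preimage_itv in_itv.
    apply/negP; rewrite -ltNge.
    move: bw; rewrite mulrC ltr_pdivrMr// mulrC; apply: le_lt_trans.
    by apply: ler_sum => i _; rewrite indic_preimage_itv in_itv.
  move=> [Gw /negP]; rewrite -ltNge => Lw; apply/andP; split.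
    apply/equantile_leP; rewrite /ecdf mulrC ler_pdivlMr// mulrC.
    apply: (le_trans Gw).
    by apply: ler_sum => i _; rewrite indic_preimage_itv in_itv.
  apply/le_equantileP; rewrite mulrC ltr_pdivrMr// mulrC; apply: le_lt_trans Lw.
  by apply: ler_sum => i _; rewrite indic_preimage_itv in_itv.
(* Each sample is either above [v] or not, so the two counts add up to [n]. Only an inclusion holds,
   as [U] includes the case of equality. *)
have UG : ~` U `<=` G.
  move=> w /negP; rewrite -ltNge => Uw; rewrite /G /=.
  have -> : \sum_(i < n) \1_(Xs i @^-1` `]-oo, v]) w
      = n%:R - \sum_(i < n) \1_(Xs i @^-1` `]v, +oo[) w :> R.
    apply/eqP; rewrite eq_sym subr_eq -big_split /=.
    rewrite (eq_bigr (fun=> 1)) ?sumr_const ?card_ord// => i _.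
    by rewrite !indic_preimage_itv !in_itv/= andbT; case: leP; rewrite ?addr0 ?add0r.
  lra.
(* Union bound over the two bad events, giving the factor 2. *)
apply: (@le_trans _ _ (P (~` (U `|` L)))).
  rewrite probability_setC; last exact: measurableU.
  rewrite EFinB leeB//; apply: (le_trans (measureU2 _ _ _)) => //.
  by rewrite mulr_natl mulr2n EFinD leeD.
apply: le_measure; rewrite ?inE.
- by apply/measurableC/measurableU.
- by apply: measurableI => //; exact: measurableC.
by rewrite setCU; apply: setSI.
Qed.
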